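(* Let $\mathcal C\subset\mathbb R^n$ be nonempty, compact and convex; let $f:\mathbb R^n\to\mathbb R$ be continuously differentiable on an open set containing $\mathcal C$ with $\nabla f$ Lipschitz-continuous on $\mathcal C$; let $T:\mathbb R^n\to\mathbb R^m$ be linear; let $\mathcal D\subset\mathbb R^m$ be nonempty, closed and convex with $\mathcal D\cap T(\mathcal C)\ne\varnothing$; let $g=\iota_{\mathcal D}$ and $\widetilde{\mathcal C}:=\mathcal C\cap T^{-1}(\mathcal D)$. Suppose there is $\kappa_{\mathrm{ind}}>0$ such that $\mathrm{dist}_{\widetilde{\mathcal C}}(x)\le\kappa_{\mathrm{ind}}\,\mathrm{dist}_{\mathcal D}(Tx)$ for every $x\in\mathcal C$. Let $L_f:=\sup_{x\in\mathcal C}\|\nabla f(x)\|_2$. Then for every $x\in\mathcal C$ and $\beta>0$, $$\mathrm{dist}_{\mathcal D}(Tx)\le\frac{L_f\kappa_{\mathrm{ind}}\beta}{2}+\frac12\sqrt{L_f^2\kappa_{\mathrm{ind}}^2\beta^2+4\beta\,\mathrm{gap}^\beta(x)}$$ and $$\left|\widetilde{\mathrm{gap}}(x)\right|\le\max\{\mathrm{gap}^\beta(x),\ L_f\kappa_{\mathrm{ind}}\,\mathrm{dist}_{\mathcal D}(Tx)\}.$$ Moreover, there is a constant $K$, independent of $x$ and $\beta$, such that for all $x\in\mathcal C$ and $\beta>0$, $\mathrm{dist}_{\mathcal D}(Tx)\le K\max\{\beta,\sqrt{\beta\,\mathrm{gap}^\beta(x)}\}$ and $|\widetilde{\mathrm{gap}}(x)|\le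 K\max\{\beta,\mathrm{gap}^\beta(x)\}$.
   Context: $\iota_{\mathcal D}$ is $0$ on $\mathcal D$ and $+\infty$ elsewhere; $\mathrm{dist}_S(y)=\inf_{u\in S}\|y-u\|_2$. For $\beta>0$ the Moreau envelope is $g^\beta(y)=\min_u\{g(u)+\frac1{2\beta}\|u-y\|_2^2\}=\frac1{2\beta}\mathrm{dist}_{\mathcal D}^2(y)$, with $\nabla g^\beta(y)=\beta^{-1}(y-\mathrm{proj}_{\mathcal D}(y))$. Smoothed Frank-Wolfe gap: for $x\in\mathcal C$, $\mathrm{gap}^\beta(x):=\max_{s\in\mathcal C}\langle\nabla f(x)+T^*\nabla g^\beta(Tx),x-s\rangle$. Signed nonsmooth Frank-Wolfe gap: $\widetilde{\mathrm{gap}}(x):=\max_{s\in\widetilde{\mathcal C}}\langle\nabla f(x),x-s\rangle$. *)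

(* Defs.v *)
From HB Require Import structures.
From mathcomp Require Import all_boot all_order all_algebra.
From mathcomp Require Import all_classical all_reals all_analysis.

Set Implicit Arguments.
Unset Strict Implicit.
Unset Printing Implicit Defensive.

Import Order.TTheory GRing.Theory Num.Theory.
Import numFieldNormedType.Exports.

Local Open Scope classical_set_scope.
Local Open Scope ring_scope.

(* R^n is 'rV[R]_n.  The library norm on 'rV[R]_n is the max norm; it is used
   only through the topology and the notion of differentiability, which do not
   depend on the choice of a norm.  All metric quantities use [enorm]. *)

Definition dotmul (R : realType) (n : nat) (u v : 'rV[R]_n) : R :=
  \sum_(i < n) u 0 i * v 0 i.

Definition enorm (R : realType) (n : nat) (u : 'rV[R]_n) : R :=
  Num.sqrt (dotmul u u).

Definition dist (R : realType) (n : nat) (S : set 'rV[R]_n) (y : 'rV[R]_n) : R :=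
  inf [set enorm (y - u) | u in S].

Definition gradient (R : realType) (n : nat) (f : 'rV[R]_n -> R)
    (x : 'rV[R]_n) : 'rV[R]_n :=
  \row_(i < n) 'D_(delta_mx 0 i) f x.

Definition continuously_differentiable_on (R : realType) (n : nat)
    (U : set 'rV[R]_n) (f : 'rV[R]_n -> R) : Prop :=
  (forall x, U x -> differentiable f x) /\ {within U, continuous (gradient f)}.

Definition enorm_lipschitz_on (R : realType) (n m : nat) (S : set 'rV[R]_n)
    (F : 'rV[R]_n -> 'rV[R]_m) : Prop :=
  exists L : R, forall x y, S x -> S y -> enorm (F x - F y) <= L * enorm (x - y).

(* [lin1_mx T] acts on row vectors from the right: [x *m lin1_mx T = T x]. *)
Definition adjoint (R : realType) (n m : nat)
    (T : {linear 'rV[R]_n -> 'rV[R]_m}) (y : 'rV[R]_m) : 'rV[R]_n :=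
  y *m (lin1_mx T)^T.

Lemma adjointP (R : realType) (n m : nat) (T : {linear 'rV[R]_n -> 'rV[R]_m})
    (x : 'rV[R]_n) (y : 'rV[R]_m) :
  dotmul (T x) y = dotmul x (adjoint T y).
Proof.
have dotE k (u v : 'rV[R]_k) : dotmul u v = (u *m v^T) 0 0.
  by rewrite mxE; apply: eq_bigr => i _; rewrite mxE.
by rewrite !dotE /adjoint trmx_mul trmxK mulmxA mul_rV_lin1.
Qed.

Definition convex_indicator (R : realType) (m : nat) (D : set 'rV[R]_m)
    (u : 'rV[R]_m) : \bar R :=
  if u \in D then 0%E else +oo%E.

Definition moreau (R : realType) (m : nat) (g : 'rV[R]_m -> \bar R) (beta : R)
    (y : 'rV[R]_m) : \bar R :=
  ereal_inf (range (fun u => (g u + ((2 * beta)^-1 * enorm (u - y) ^+ 2)%:E)%E)).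

Definition grad_moreau (R : realType) (m : nat) (g : 'rV[R]_m -> \bar R)
    (beta : R) (y : 'rV[R]_m) : 'rV[R]_m :=
  gradient (fun z => fine (moreau g beta z)) y.

Definition fw_gap (R : realType) (n : nat) (S : set 'rV[R]_n)
    (v x : 'rV[R]_n) : R :=
  sup [set dotmul v (x - s) | s in S].

(* On the sets considered the supremum is a maximum. *)
Lemma fw_gap_max (R : realType) (n : nat) (S : set 'rV[R]_n) (v x : 'rV[R]_n) :
  compact S -> S !=set0 ->
  exists2 s, S s & fw_gap S v x = dotmul v (x - s) /\
    forall t, S t -> dotmul v (x - t) <= dotmul v (x - s).
Proof.
move=> cS S0.
have cf : continuous (fun s : 'rV[R]_n => dotmul v (x - s)).
  have -> : (fun s => dotmul v (x - s)) =
            (fun s => \sum_(i < n) v 0 i * (x 0 i - s 0 i)).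
    by apply/funext => s; apply: eq_bigr => i _; rewrite !mxE.
  apply: continuous_big => [|i _ s]; first exact: add_continuous.
  apply: (@continuousM R _ (fun=> v 0 i) (fun s : 'rV[R]_n => x 0 i - s 0 i)).
    exact: cst_continuous.
  apply: (@continuousB R R _ (fun=> x 0 i) (fun s : 'rV[R]_n => s 0 i)).
    exact: cst_continuous.
  exact: coord_continuous.
have [s /set_mem Ss smax] := EVT_max_rV S0 cS (continuous_subspaceT cf).
have ub : ubound [set dotmul v (x - t) | t in S] (dotmul v (x - s)).
  by move=> _ [t St <-]; apply: smax; exact: mem_set.
exists s => //; split; last by move=> t St; apply: ub; exists t.
apply/eqP; rewrite eq_le; apply/andP; split.
  by apply: ge_sup => //; exists (dotmul v (x - s)), s.
by apply: ub_le_sup; [exists (dotmul v (x - s)) | exists s].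
Qed.

Definition smoothed_gap (R : realType) (n m : nat) (C : set 'rV[R]_n)
    (f : 'rV[R]_n -> R) (T : {linear 'rV[R]_n -> 'rV[R]_m})
    (D : set 'rV[R]_m) (beta : R) (x : 'rV[R]_n) : R :=
  fw_gap C (gradient f x + adjoint T (grad_moreau (convex_indicator D) beta (T x))) x.

Definition feasible (R : realType) (n m : nat) (C : set 'rV[R]_n)
    (T : {linear 'rV[R]_n -> 'rV[R]_m}) (D : set 'rV[R]_m) : set 'rV[R]_n :=
  C `&` T @^-1` D.

Definition signed_gap (R : realType) (n m : nat) (C : set 'rV[R]_n)
    (f : 'rV[R]_n -> R) (T : {linear 'rV[R]_n -> 'rV[R]_m})
    (D : set 'rV[R]_m) (x : 'rV[R]_n) : R :=
  fw_gap (feasible C T D) (gradient f x) x.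

Definition sup_grad (R : realType) (n : nat) (C : set 'rV[R]_n)
    (f : 'rV[R]_n -> R) : R :=
  sup [set enorm (gradient f x) | x in C].

(* Main.v *)
(** Let [d = dist D (T x)] and let [p] be the projection of [y = T x] on [D].
    The gradient of the Moreau envelope at [y] is [(y - p) / beta], and the
    variational inequality [0 <= <y - p, p - u>] for [u] in [D] gives
    [<grad f x, x - s> + d^2 / beta <= gap^beta x] for every feasible [s].
    Maximizing over [s] bounds the signed gap above by [gap^beta x]; taking for
    [s] the feasible point nearest to [x], Cauchy-Schwarz and the regularity
    hypothesis give [<grad f x, x - s> >= - L_f kappa d], which bounds the signed
    gap below and leaves a quadratic inequality in [d].
    The envelope is differentiated from a sandwich: by the variational inequality
    [|y + h - u|^2 >= |y - p|^2 + 2 <y - p, h>] for all [u] in [D], while [u = p]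
    attains this bound plus [|h|^2]. *)

Require Import Defs.
From mathcomp Require Import all_boot all_order all_algebra.
From mathcomp Require Import all_classical all_reals all_analysis.
From mathcomp Require Import ring lra.

Import Order.TTheory GRing.Theory Num.Theory.
Import numFieldNormedType.Exports.

Local Open Scope classical_set_scope.
Local Open Scope ring_scope.

(** * Euclidean inner product and norm on row vectors *)

Section EuclideanNorm.
Context {R : realType} {n : nat}.
Implicit Types (u v w : 'rV[R]_n) (c : R).

Lemma dotmulC u v : dotmul u v = dotmul v u.
Proof. by apply: eq_bigr => i _; rewrite mulrC. Qed.

Lemma dotmulDl u v w : dotmul (u + v) w = dotmul u w + dotmul v w.
Proof.
by rewrite /dotmul -big_split; apply: eq_bigr => i _; rewrite mxE mulrDl.
Qed.

Lemma dotmulZl c u v : dotmul (c *: u) v = c * dotmul u v.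
Proof. by rewrite /dotmul mulr_sumr; apply: eq_bigr => i _; rewrite mxE mulrA. Qed.

Lemma dotmulDr u v w : dotmul w (u + v) = dotmul w u + dotmul w v.
Proof. by rewrite !(dotmulC w) dotmulDl. Qed.

Lemma dotmulZr c u v : dotmul u (c *: v) = c * dotmul u v.
Proof. by rewrite !(dotmulC u) dotmulZl. Qed.

Lemma dotmulNr u v : dotmul u (- v) = - dotmul u v.
Proof. by rewrite -scaleN1r dotmulZr mulN1r. Qed.

Lemma dotmulNl u v : dotmul (- u) v = - dotmul u v.
Proof. by rewrite !(dotmulC _ v) dotmulNr. Qed.

Lemma dotmul0r u : dotmul u 0 = 0.
Proof. by rewrite -(scale0r 0) dotmulZr mul0r. Qed.

Lemma dotmul_ge0 u : 0 <= dotmul u u.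
Proof. by apply: sumr_ge0 => i _; rewrite -expr2 sqr_ge0. Qed.

Lemma dotmul_eq0 u : (dotmul u u == 0) = (u == 0).
Proof.
apply/eqP/eqP => [u0|->]; last exact: dotmul0r.
apply/rowP => i; rewrite mxE; apply/eqP; rewrite -sqrf_eq0 expr2.
have u_ge0 j : true -> 0 <= u 0 j * u 0 j by rewrite -expr2 sqr_ge0.
by apply/eqP; exact: (psumr_eq0P u_ge0 u0).
Qed.

Lemma dotmul_delta u i : dotmul u (delta_mx 0 i) = u 0 i.
Proof.
rewrite /dotmul (bigD1 i) //= big1 => [|j ji]; last by rewrite !mxE (negbTE ji) mulr0.
by rewrite !mxE !eqxx mulr1 addr0.
Qed.

Lemma enorm_ge0 u : 0 <= enorm u.
Proof. exact: sqrtr_ge0. Qed.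

Lemma sqr_enorm u : enorm u ^+ 2 = dotmul u u.
Proof. by rewrite sqr_sqrtr ?dotmul_ge0. Qed.

Lemma sqr_enormD u v :
  enorm (u + v) ^+ 2 = enorm u ^+ 2 + 2 * dotmul u v + enorm v ^+ 2.
Proof.
by rewrite !sqr_enorm dotmulDl !dotmulDr (dotmulC v u); ring.
Qed.

Lemma enormN u : enorm (- u) = enorm u.
Proof. by rewrite /enorm dotmulNl dotmulNr opprK. Qed.

(** For [v != 0], the squared norm of [<v,v> u - <u,v> v] is [<v,v>] times [<u,u><v,v> - <u,v>^2],
    and the first factor is positive. *)
Lemma cauchy_schwarz u v : `|dotmul u v| <= enorm u * enorm v.
Proof.
rewrite -[leRHS]ger0_norm ?mulr_ge0 ?enorm_ge0 // -ler_sqr ?nnegrE //.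
rewrite !real_normK ?num_real // exprMn !sqr_enorm.
have [v0|v0] := eqVneq v 0.
  by rewrite v0 !dotmul0r expr0n mulr0.
have vv : 0 < dotmul v v by rewrite lt_def dotmul_eq0 v0 dotmul_ge0.
have := dotmul_ge0 (dotmul v v *: u - dotmul u v *: v).
rewrite dotmulDl !dotmulDr !(dotmulNr, dotmulNl, dotmulZl, dotmulZr).
rewrite (dotmulC v u).
move=> h; rewrite -subr_ge0 -(pmulr_rge0 _ vv); move: h.
by congr (_ <= _); ring.
Qed.

(** Turns Euclidean bounds into bounds for the max norm, in which [bounded_set] is phrased. *)
Lemma norm_le_enorm u : `|u| <= enorm u.
Proof.
rewrite [leLHS]/Num.norm /= mx_normrE; apply/bigmax_leP; split=> [|[k i] _ /=].
  exact: enorm_ge0.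
by rewrite ord1 -sqrtr_sqr ler_wsqrtr // /dotmul (bigD1 i) //= expr2 lerDl
  sumr_ge0 // => j _; rewrite -expr2 sqr_ge0.
Qed.

Lemma enorm_continuous : continuous (@enorm R n).
Proof.
move=> u; apply: continuous_comp; last exact: sqrt_continuous.
apply: continuous_big => [|i _]; first exact: add_continuous.
by move=> v; apply: continuousM; exact: coord_continuous.
Qed.

Lemma enormB_continuous u : continuous (fun v => enorm (u - v)).
Proof.
move=> v; apply: continuous_comp; last exact: enorm_continuous.
apply: (@continuousB R _ _ (fun=> u) id); first exact: cst_continuous.
by move=> ?.
Qed.

End EuclideanNorm.

Lemma row_linear_continuous (R : realType) (n m : nat)
    (T : {linear 'rV[R]_n -> 'rV[R]_m}) : continuous T.
Proof.
move=> x; apply/(@cvg_ballP _ _ _ _ (nbhs_filter x) T (T x)) => e e0.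
suff coordT j : \forall t \near x, ball (T x 0 j) e (T t 0 j).
  have := @filter_forall _ _ _ _ (nbhs_filter x) coordT.
  by apply: (@filterS _ _ (nbhs_filter x)) => t Tt; split => // i j; rewrite ord1; exact: Tt.
have /cvg_ballP : {for x, continuous (fun t => T t 0 j)}; last by apply.
have -> : (fun t => T t 0 j) = fun t => \sum_k t 0 k * lin1_mx T k j.
  by apply/funext => t; rewrite -mul_rV_lin1 mxE.
apply: continuous_big => [|k _ t]; first exact: add_continuous.
apply: (@continuousM R _ (fun t : 'rV[R]_n => t 0 k) (fun=> _)).
  exact: coord_continuous.
exact: cst_continuous.
Qed.

(** * Nearest points and the variational inequality of the projection *)

Section Projection.
Context {R : realType} {n : nat} (S : set 'rV[R]_n).

Lemma dist_le (x u : 'rV[R]_n) : S u -> dist S x <= enorm (x - u).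
Proof.
move=> Su; apply: ge_inf; last by exists u.
by exists 0 => _ [v _ <-]; exact: enorm_ge0.
Qed.

(** [S] may be unbounded, so the minimum is taken over its compact part [K] of points no farther
    from [x] than a chosen [u0]; the other points of [S] are beaten by [u0]. *)
Lemma dist_attained (x : 'rV[R]_n) : S !=set0 -> closed S ->
  exists2 p, S p & dist S x = enorm (x - p).
Proof.
move=> [u0 Su0] Scl; pose r := enorm (x - u0).
pose K := S `&` (fun u => enorm (x - u)) @^-1` [set t | t <= r].
have Kcl : closed K.
  apply: closedI => //; apply: preimage_closed; last exact: closed_le.
  by move=> u _; exact: enormB_continuous.
have Kb : bounded_set K.
  exists (`|x| + r); split; first exact: num_real.
  move=> M xM u [_ /= ur]; rewrite (le_trans _ (ltW xM)) //.
  have -> : u = x - (x - u) by rewrite opprB addrC subrK.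
  by rewrite (le_trans (ler_normB _ _)) // lerD2l (le_trans (norm_le_enorm _)).
have K0 : K !=set0 by exists u0; split => //=.
have [p /set_mem [Sp _] pmin] := EVT_min_rV K0 (bounded_closed_compact Kb Kcl)
  (continuous_subspaceT (enormB_continuous x)).
exists p => //; apply/eqP; rewrite eq_le dist_le //=.
apply: lb_le_inf; first by exists r, u0.
move=> _ [u Su <-]; have [ur|/ltW ur] := leP (enorm (x - u)) r.
  by apply: pmin; exact: mem_set.
by apply: le_trans ur; apply: pmin; apply: mem_set; split => /=.
Qed.

(** By convexity the point [p + t (u - p)] lies in [S], hence is no closer to [x] than [p]; a
    negative inner product would contradict this for small [t]. *)
Lemma projection_variational (x p u : 'rV[R]_n) : convex_set S ->
  S p -> dist S x = enorm (x - p) -> S u -> 0 <= dotmul (x - p) (p - u).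
Proof.
move=> Scv Sp xp Su; set w := x - p; set q := p - u.
have small t : 0 <= t -> t <= 1 -> 0 <= t * (2 * dotmul w q + t * enorm q ^+ 2).
  move=> t0 t1; have := Scv u p (Itv01 t0 t1) (mem_set Su) (mem_set Sp).
  move=> /set_mem /(dist_le x).
  rewrite xp -/w -ler_sqr ?nnegrE ?enorm_ge0 //.
  have -> : x - conv (Itv01 t0 t1) (u : convex_lmodType _) p = w + t *: q.
    rewrite /conv /= /w /q; apply/rowP => i; rewrite !mxE /unstable.onem; ring.
  rewrite (sqr_enormD w (t *: q)) dotmulZr -subr_ge0 => h; apply: le_trans h _.
  by rewrite !sqr_enorm dotmulZl dotmulZr; lra.
rewrite leNgt; apply/negP => wq0.
(* The step [t = a / (a + Q)] lies in []0, 1]] even when [Q = 0], and [t Q <= a] makes [-2a + t Q]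
   negative. *)
set a := - dotmul w q; set Q := enorm q ^+ 2.
have a0 : 0 < a by rewrite oppr_gt0.
have Q0 : 0 <= Q by rewrite sqr_ge0.
have aQ : 0 < a + Q by rewrite ltr_wpDr.
have t0 : 0 < a / (a + Q) by rewrite divr_gt0.
have t1 : a / (a + Q) <= 1 by rewrite ler_pdivrMr // mul1r lerDl.
have := small _ (ltW t0) t1; rewrite pmulr_rge0 //.
have : a / (a + Q) * Q <= a.
  by rewrite mulrAC ler_pdivrMr // ler_pM2l // lerDr ltW.
rewrite -/Q /a; lra.
Qed.

End Projection.

(** * Gradient of the Moreau envelope of an indicator *)

Section MoreauEnvelope.
Context {R : realType} {m : nat} (D : set 'rV[R]_m) (beta : R).
Hypotheses (D_convex : convex_set D) (beta_gt0 : 0 < beta).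

(** The two bounds differ by a term quadratic in [h], so they determine both the value and the
    gradient at [y]. *)
Lemma moreau_indicator_bounds (y p h : 'rV[R]_m) :
    D p -> dist D y = enorm (y - p) ->
  let phi := fine (moreau (convex_indicator D) beta (y + h)) in
  let a := enorm (y - p) ^+ 2 + 2 * dotmul (y - p) h in
  (2 * beta)^-1 * a <= phi <= (2 * beta)^-1 * (a + enorm h ^+ 2).
Proof.
move=> Dp yp /=; set a := _ + 2 * _.
have b0 : 0 <= (2 * beta)^-1 by rewrite invr_ge0 mulr_ge0 // ltW.
set M := moreau _ _ _.
have lo : (((2 * beta)^-1 * a)%:E <= M)%E.
  apply: le_ereal_inf_tmp => _ [u _ <-]; rewrite /convex_indicator.
  case: ifPn => [/set_mem Du|_]; last by rewrite addye ?leey.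
  rewrite add0e lee_fin ler_wpM2l // -[X in enorm X]opprB enormN.
  (* Expanding this sum leaves [a] plus two nonnegative terms: [2 <y - p, p - u>] and the last
     square. *)
  have -> : y + h - u = (y - p) + (h + (p - u)).
    by apply/rowP => i; rewrite !mxE; ring.
  rewrite [leRHS]sqr_enormD dotmulDr /a.
  have := projection_variational _ _ _ _ D_convex Dp yp Du.
  by have := sqr_ge0 (enorm (h + (p - u))); lra.
have hi : (M <= ((2 * beta)^-1 * (a + enorm h ^+ 2))%:E)%E.
  apply: ge_ereal_inf; exists ((2 * beta)^-1 * enorm (p - (y + h)) ^+ 2)%:E.
    by exists p => //; rewrite /convex_indicator mem_set // add0e.
  rewrite lee_fin ler_wpM2l // -[X in enorm X]opprB enormN.
  by rewrite addrAC sqr_enormD /a.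
(* [fine] collapses infinite values to 0, so the bounds pass to reals only once [M] is known to be
   finite. *)
have Mfin : M \is a fin_num.
  rewrite fin_numE; apply/andP; split; apply/eqP => MN.
    by move: lo; rewrite MN leeNy_eq.
  by move: hi; rewrite MN leye_eq.
by rewrite -!lee_fin fineK // lo hi.
Qed.

Lemma grad_moreau_indicator (y p : 'rV[R]_m) :
    D p -> dist D y = enorm (y - p) ->
  grad_moreau (convex_indicator D) beta y = beta^-1 *: (y - p).
Proof.
move=> Dp yp; apply/rowP => i; rewrite !mxE.
set e := delta_mx 0 i; set phi := fun z => fine _.
have b2 : 0 < (2 * beta)^-1 by rewrite invr_gt0 mulr_gt0.
have wi : y 0 i - p 0 i = dotmul (y - p) e by rewrite dotmul_delta !mxE.
rewrite wi; set l := beta^-1 * _.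
have l2 : l = (2 * beta)^-1 * (2 * dotmul (y - p) e).
  by rewrite /l; field; rewrite gt_eqF.
(* At [h = 0] the two bounds coincide. *)
have phi0 : phi y = (2 * beta)^-1 * enorm (y - p) ^+ 2.
  have := moreau_indicator_bounds y p 0 Dp yp.
  rewrite /= addr0 (sqr_enorm 0) !dotmul0r mulr0 !addr0 => /andP[l1 l3].
  by apply/eqP; rewrite eq_le /phi l1 l3.
rewrite /derive; apply: cvg_lim => //.
(* The sandwich at [h = t e], divided by [t]: the difference quotient misses [l] by at most a
   multiple of [|t|]. *)
have bound t : t != 0 ->
    `|l - t^-1 * (phi (t *: e + y) - phi y)| <=
    (2 * beta)^-1 * enorm e ^+ 2 * `|t|.
  move=> t0; have := moreau_indicator_bounds y p (t *: e) Dp yp.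
  rewrite /= -/(phi _) (addrC y (t *: e)) dotmulZr => /andP[lo hi].
  have tN : 0 < `|t| by rewrite normr_gt0.
  have -> : l - t^-1 * (phi (t *: e + y) - phi y) =
      - (t^-1 * (phi (t *: e + y) - phi y - t * l)) by field.
  rewrite normrN normrM normfV ler_pdivrMl //.
  have tt : `|t| * ((2 * beta)^-1 * enorm e ^+ 2 * `|t|) =
      (2 * beta)^-1 * enorm (t *: e) ^+ 2.
    by rewrite !sqr_enorm dotmulZl dotmulZr mulrCA -expr2 real_normK ?num_real //; ring.
  rewrite tt phi0 l2 ger0_norm; lra.
apply/cvgrPdist_le => eps eps0.
set c := _ * _ ^+ 2 in bound.
have c0 : 0 <= c by rewrite mulr_ge0 ?sqr_ge0 // ltW.
near=> t; rewrite /= (le_trans (bound _ _)) //.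
  by near: t; exact: nbhs_dnbhs_neq.
(* [c + 1] replaces [c] as a denominator because only [0 <= c] is known. *)
have : `|t| <= eps / (c + 1) by near: t; apply: dnbhs0_le; rewrite divr_gt0 // ltr_wpDl.
rewrite ler_pdivlMr ?ltr_wpDl // => /(le_trans _); apply.
by rewrite mulrC ler_wpM2l // lerDl.
Unshelve. all: by end_near.
Qed.

End MoreauEnvelope.

(** * Bounds relating the signed gap, the smoothed gap and the distance *)

Lemma fw_gap_ge (R : realType) (n : nat) (S : set 'rV[R]_n) (v x s : 'rV[R]_n) :
  compact S -> S s -> dotmul v (x - s) <= fw_gap S v x.
Proof.
move=> cS Ss; have S0 : S !=set0 by exists s.
by have [t _ [-> tmax]] := fw_gap_max v x cS S0; exact: tmax.
Qed.

(** A real [sup] dominates its set only if the set is bounded above; here continuity on the compact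
    [C] provides the bound. *)
Lemma gradient_le_sup (R : realType) (n : nat) (C : set 'rV[R]_n)
    (f : 'rV[R]_n -> R) (x : 'rV[R]_n) :
  compact C -> {within C, continuous (gradient f)} -> C x ->
  enorm (gradient f x) <= sup_grad C f.
Proof.
move=> cC cf Cx; have C0 : C !=set0 by exists x.
have cN : {within C, continuous (fun z => enorm (gradient f z))}.
  by move=> z; apply: continuous_comp; [exact: cf | exact: enorm_continuous].
have [c _ cmax] := EVT_max_rV C0 cC cN.
apply: ub_le_sup; last by exists x.
by exists (enorm (gradient f c)) => _ [z Cz <-]; apply: cmax; exact: mem_set.
Qed.

Lemma feasible_compact (R : realType) (n m : nat) (C : set 'rV[R]_n)
    (T : {linear 'rV[R]_n -> 'rV[R]_m}) (D : set 'rV[R]_m) :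
  compact C -> closed D -> compact (feasible C T D).
Proof.
move=> cC clD; apply: compact_closedI => //; apply: preimage_closed => // x _.
exact: row_linear_continuous.
Qed.

Lemma smoothed_gap_ge (R : realType) (n m : nat) (C : set 'rV[R]_n)
    (f : 'rV[R]_n -> R) (T : {linear 'rV[R]_n -> 'rV[R]_m})
    (D : set 'rV[R]_m) (beta : R) (x s : 'rV[R]_n) :
  compact C -> closed D -> convex_set D -> 0 < beta -> feasible C T D s ->
  dotmul (gradient f x) (x - s) + dist D (T x) ^+ 2 / beta <=
    smoothed_gap C f T D beta x.
Proof.
move=> cC clD cvD b0 [Cs Ds].
have D0 : D !=set0 by exists (T s).
have [p Dp xp] := dist_attained D (T x) D0 clD.
rewrite /smoothed_gap; apply: le_trans (fw_gap_ge _ _ _ _ x s cC Cs).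
rewrite (grad_moreau_indicator D beta cvD b0 (T x) p Dp xp) dotmulDl lerD2l.
(* The adjoint moves [T] onto [x - s], so the inequality becomes one between vectors of the space of
   [D]. *)
rewrite (dotmulC (adjoint _ _)) -adjointP linearB dotmulZr mulrC.
rewrite ler_pM2l ?invr_gt0 // xp sqr_enorm.
have -> : T x - T s = (T x - p) + (p - T s) by rewrite addrA subrK.
by rewrite (dotmulDl (T x - p)) (dotmulC (p - _)) lerDl (projection_variational _ _ _ _ cvD Dp xp).
Qed.

(** The square of the distance is kept in the second bound: dropping it bounds the signed gap above,
    while eliminating the signed gap between the two bounds gives the quadratic inequality. *)
Lemma signed_gap_bounds (R : realType) (n m : nat) (C : set 'rV[R]_n)
    (f : 'rV[R]_n -> R) (T : {linear 'rV[R]_n -> 'rV[R]_m})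
    (D : set 'rV[R]_m) (kappa beta : R) (x : 'rV[R]_n) :
    compact C -> closed D -> convex_set D -> feasible C T D !=set0 ->
    {within C, continuous (gradient f)} -> C x -> 0 < beta ->
    dist (feasible C T D) x <= kappa * dist D (T x) ->
  - (sup_grad C f * kappa * dist D (T x)) <= signed_gap C f T D x /\
  signed_gap C f T D x + dist D (T x) ^+ 2 / beta <=
    smoothed_gap C f T D beta x.
Proof.
move=> cC clD cvD F0 cf Cx b0 xkappa.
have cF := feasible_compact _ _ _ _ T D cC clD.
split; last first.
  have [s Fs [gs _]] := fw_gap_max (gradient f x) x cF F0.
  by rewrite /signed_gap gs; exact: smoothed_gap_ge.
have clF := compact_closed (@norm_hausdorff _ _) cF.
have [s Fs xs] := dist_attained _ x F0 clF.
apply: le_trans (fw_gap_ge _ _ _ (gradient f x) x s cF Fs).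
have /ler_normlP[+ _] := cauchy_schwarz (gradient f x) (x - s).
rewrite lerNl => le_cs; apply: le_trans le_cs; rewrite lerN2 -mulrA.
by apply: ler_pM; rewrite ?enorm_ge0 ?gradient_le_sup // -xs.
Qed.

(** * From the quadratic inequality to the final estimates *)

Lemma quadratic_root_bound (R : rcfType) (b c d : R) :
  d ^+ 2 <= b * d + c -> d <= b / 2 + 2^-1 * Num.sqrt (b ^+ 2 + 4 * c).
Proof.
(* Completing the square turns the hypothesis into [(2d - b)^2 <= b^2 + 4c]. *)
move=> dbc; have : 2 * d - b <= Num.sqrt (b ^+ 2 + 4 * c).
  apply: le_trans (ler_norm _) _; rewrite -sqrtr_sqr ler_wsqrtr //.
  by move: dbc; rewrite -subr_ge0 => h; rewrite -subr_ge0; nra.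
by lra.
Qed.

Theorem lemma6p3 (R : realType) (n m : nat)
    (C : set 'rV[R]_n) (f : 'rV[R]_n -> R)
    (T : {linear 'rV[R]_n -> 'rV[R]_m}) (D : set 'rV[R]_m) (kappa : R)
    (C_nonempty : C !=set0) (C_compact : compact C) (C_convex : convex_set C)
    (f_C1 : exists U : set 'rV[R]_n,
        [/\ open U, C `<=` U & continuously_differentiable_on U f])
    (f_lip : enorm_lipschitz_on C (gradient f))
    (D_nonempty : D !=set0) (D_closed : closed D) (D_convex : convex_set D)
    (DTC : (D `&` (T @` C)) !=set0)
    (kappa_gt0 : 0 < kappa)
    (kappa_ind : forall x, C x ->
        dist (feasible C T D) x <= kappa * dist D (T x)) :
  (forall (x : 'rV[R]_n) (beta : R), C x -> 0 < beta ->
     dist D (T x) <=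
       sup_grad C f * kappa * beta / 2 +
       2^-1 * Num.sqrt (sup_grad C f ^+ 2 * kappa ^+ 2 * beta ^+ 2 +
                        4 * beta * smoothed_gap C f T D beta x)
     /\
     `|signed_gap C f T D x| <=
       Num.max (smoothed_gap C f T D beta x)
               (sup_grad C f * kappa * dist D (T x)))
  /\
  (exists K : R, forall (x : 'rV[R]_n) (beta : R), C x -> 0 < beta ->
     dist D (T x) <=
       K * Num.max beta (Num.sqrt (beta * smoothed_gap C f T D beta x))
     /\
     `|signed_gap C f T D x| <=
       K * Num.max beta (smoothed_gap C f T D beta x)).
Proof.
have [U [_ CU [_ cU]]] := f_C1.
have cf := continuous_subspaceW CU cU.
have F0 : feasible C T D !=set0.
  by have [y [Dy [s Cs sy]]] := DTC; exists s; split => //=; rewrite sy.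
set L := sup_grad C f.
have L0 : 0 <= L.
  have [c Cc] := C_nonempty.
  exact: le_trans (enorm_ge0 _) (gradient_le_sup _ _ _ _ _ C_compact cf Cc).
have d0 x : 0 <= dist D (T x).
  by have [p _ ->] := dist_attained _ (T x) D_nonempty D_closed; exact: enorm_ge0.
(* The choice [s = x] contributes the value 0 to the maximum. *)
have G0 x beta : C x -> 0 <= smoothed_gap C f T D beta x.
  move=> Cx; rewrite /smoothed_gap; set v := gradient f x + _.
  by have := fw_gap_ge _ _ _ v x x C_compact Cx; rewrite subrr dotmul0r.
have main (x : 'rV[R]_n) (beta : R) : C x -> 0 < beta ->
     dist D (T x) <= L * kappa * beta / 2 + 2^-1 *
       Num.sqrt (L ^+ 2 * kappa ^+ 2 * beta ^+ 2 +
                 4 * beta * smoothed_gap C f T D beta x)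
     /\ `|signed_gap C f T D x| <=
       Num.max (smoothed_gap C f T D beta x) (L * kappa * dist D (T x)).
  move=> Cx b0.
  have [lo hi] := signed_gap_bounds _ _ _ _ f _ _ _ _ _ C_compact D_closed D_convex
    F0 cf Cx b0 (kappa_ind x Cx).
  split.
    (* Here [b = L kappa beta] and [c] is [beta] times the smoothed gap. *)
    rewrite -!exprMn -(mulrA 4); apply: quadratic_root_bound.
    have : dist D (T x) ^+ 2 / beta <=
        smoothed_gap C f T D beta x + L * kappa * dist D (T x).
      by move: lo hi; rewrite -/L; lra.
    by rewrite ler_pdivrMr // => h; apply: le_trans h _; rewrite le_eqVlt;
      apply/orP; left; apply/eqP; ring.
  have gle : signed_gap C f T D x <= smoothed_gap C f T D beta x.
    by apply: le_trans hi; rewrite lerDl divr_ge0 ?sqr_ge0 // ltW.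
  by rewrite ler_norml lerNl !le_max gle orbC lerNl lo.
split; first exact: main.
set A := L * kappa; have A0 : 0 <= A by rewrite mulr_ge0 // ltW.
(* The constant dominates [A + 1] for the distance, and both 1 and [A (A + 1)] for the two terms of
   the maximum bounding the signed gap. *)
exists (1 + A * (A + 1) + A) => x beta Cx b0.
have [hd hs] := main x beta Cx b0.
set d := dist D (T x) in hd hs *; set G := smoothed_gap _ _ _ _ _ _ in hd hs *.
have G_ge0 : 0 <= G by exact: G0.
set M := Num.max beta (Num.sqrt (beta * G)).
have M0 : 0 <= M by rewrite le_max ltW.
have bM : beta <= M by rewrite le_max lexx.
have sM : Num.sqrt (beta * G) <= M by rewrite le_max lexx orbT.
have bGM : beta * G <= M ^+ 2.
  by rewrite -(@sqr_sqrtr _ (beta * G)) ?mulr_ge0 ?ler_sqr ?nnegrE ?sqrtr_ge0 // ltW.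
have dM : d <= (A + 1) * M.
  (* The radicand is at most [(A^2 + 4) M^2 <= (A + 2)^2 M^2]; half of [A beta + (A + 2) M] is then
     at most [(A + 1) M]. *)
  have : Num.sqrt (L ^+ 2 * kappa ^+ 2 * beta ^+ 2 + 4 * beta * G) <= (A + 2) * M.
    rewrite -(@ger0_norm _ ((A + 2) * M)) ?mulr_ge0 ?addr_ge0 // -sqrtr_sqr.
    rewrite ler_wsqrtr // -exprMn -/A -mulrA.
    have bM2 : beta ^+ 2 <= M ^+ 2 by rewrite ler_sqr ?nnegrE // ltW.
    have := ler_wpM2l (sqr_ge0 A) bM2.
    have : 0 <= A * M ^+ 2 by rewrite mulr_ge0 ?sqr_ge0.
    by rewrite -exprMn; nra.
  have := ler_wpM2l A0 bM; rewrite /A in hd *; lra.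
set N := Num.max beta G.
have bN : beta <= N by rewrite le_max lexx.
have GN : G <= N by rewrite le_max lexx orbT.
have N0 : 0 <= N by exact: le_trans GN.
(* Since [beta] and [G] are both at most [N], so is their geometric mean; the distance bound thus
   also holds with [N]. *)
have MN : M <= N.
  rewrite ge_max bN /= -(@ger0_norm _ N) // -sqrtr_sqr ler_wsqrtr // expr2.
  by apply: ler_pM => //; exact: ltW.
have AA : 0 <= A * (A + 1) by rewrite mulr_ge0 ?addr_ge0.
split.
  apply: le_trans dM _; rewrite ler_wpM2r //; lra.
apply: le_trans hs _; rewrite ge_max; apply/andP; split.
  apply: le_trans GN _; rewrite -[leLHS]mul1r ler_wpM2r //; lra.
apply: (@le_trans _ _ (A * (A + 1) * N)); last by rewrite ler_wpM2r //; lra.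
by rewrite -/A -[leRHS]mulrA ler_wpM2l // (le_trans dM) // ler_wpM2l ?addr_ge0.
Qed.
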